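(* Let $\Omega\subset\mathbb{C}$ be open, connected and bounded, and let $(f_n)_{n\in\mathbb{N}}$ be a sequence in $\mathcal{A}(\Omega)\cap C(\overline{\Omega})$ such that the sequence of restrictions $(f_n|_{\partial\Omega})_{n\in\mathbb{N}}$ converges uniformly on $\partial\Omega$. Then: (a) For every $k\in\mathbb{N}$, the sequence $(f_n^{(k)})_{n\in\mathbb{N}}$ converges compactly on $\Omega$. (b) If $f=\lim f_n$, then $f\in\mathcal{A}(\Omega)\cap C(\overline{\Omega})$. (c) The sequence $(f_n^{(k)})_{n\in\mathbb{N}}$ converges compactly to $f^{(k)}$ on $\Omega$, for every $k\in\mathbb{N}$.
   Context: $\mathbb{N}=\{0,1,2,\dots\}$. A function on an open set $\Omega\subset\mathbb{C}$ is analytic if around each $z_0\in\Omega$ it is given on some open disk centered at $z_0$ and contained in $\Omega$ by a convergent power series in $z-z_0$; $\mathcal{A}(\Omega)$ is the set of analytic functions in $\Omega$. $C(\overline{\Omega})$ is the set of continuous functions $\overline{\Omega}\to\mathbb{C}$, and $\mathcal{A}(\Omega)\cap C(\overline{\Omega})$ is the set of continuous functions on $\overline{\Omega}$ whose restriction to $\Omega$ is analytic. $\partial\Omega$ is the topological boundary of $\Omega$ in $\mathbb{C}$. A sequence of continuous functions converges compactly on $\Omega$ if it converges uniformly on every compact subset of $\Omega$. The limit $f=\lim f_n$ is taken on $\overline{\Omega}$, and $g^{(k)}$ denotes the $k$-th complex derivative on $\Omega$. *)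

(* Defs.v *)
From HB Require Import structures.
From mathcomp Require Import all_boot all_order all_algebra.
From mathcomp Require Import complex.
From mathcomp Require Import all_classical all_reals all_analysis.

Set Implicit Arguments.
Unset Strict Implicit.
Unset Printing Implicit Defensive.

Import Order.TTheory GRing.Theory Num.Theory numFieldNormedType.Exports.

Local Open Scope classical_set_scope.
Local Open Scope ring_scope.

(* The structure type is fixed here so that [Cplx R] is inferred as a normed
   module over itself, which [derive1n] needs; [R[i]] alone is not. *)
Definition Cplx (R : realType) : numClosedFieldType := R[i].

Definition boundary {T : topologicalType} (A : set T) : set T :=
  closure A `\` interior A.

(* Functions are total; only the values on Omega matter. As 0 < r in the partial
   order of the complex numbers, r is a positive real. *)
Definition analytic {R : realType} (Omega : set (Cplx R)) :
    set (Cplx R -> Cplx R) :=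
  [set f | forall z0, Omega z0 ->
     exists r : Cplx R, exists a : nat -> Cplx R,
       [/\ 0 < r, ball z0 r `<=` Omega &
           forall z, ball z0 r z ->
             series (fun k => a k * (z - z0) ^+ k) @ \oo --> f z]].

Definition continuous_closure {R : realType} (Omega : set (Cplx R)) :
    set (Cplx R -> Cplx R) :=
  [set f | {within closure Omega, continuous f}].

(* [{family compactly_in Omega, F --> g}] is uniform convergence on each compact
   subset of Omega. *)
Definition cvg_compactly {R : realType} (Omega : set (Cplx R))
    (g_ : nat -> Cplx R -> Cplx R) (g : Cplx R -> Cplx R) : Prop :=
  {family compactly_in Omega, g_ @ \oo --> g}.

(* Main.v *)
Require Import Defs.
From HB Require Import structures.
From mathcomp Require Import all_boot all_order all_algebra.
From mathcomp Require Import complex.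
From mathcomp Require Import all_classical all_reals all_analysis.
From mathcomp Require Import ring lra.

(** The whole statement follows from one bound that needs neither contour
    integrals nor the theory of the radius of convergence.

    Write [dslope w f] for the slope [z |-> (f z - f w) / (z - w)], completed at
    [w] by the derivative.  If [f] is analytic near the closed disc of centre [w]
    and radius [r], so is its slope, and on the circle [|z - w| = r] the slope is
    at most [2 M / r], where [M] bounds [|f|] on the disc.  The maximum principle
    carries this bound to the whole disc ([dslope_bound], a form of the Schwarz
    lemma).  Iterating [k] times bounds the [k]-th slope by [(2 / r)^k M], and
    unfolding the definition of the slopes gives
      f z = a_0 + a_1 (z - w) + ... + a_(k-1) (z - w)^(k-1) + (z - w)^k g_k(z),
    where [g_k] is the [k]-th slope and [a_j = g_j(w)].  So the power series at
    [w] of every function analytic on the disc converges to it at distance less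
    than [r / 2], with error at most [M (2 |z - w| / r)^k].  Neither the radius
    nor the error bound depends on the function, apart from [M]; they therefore
    survive a uniform limit, and the limit is again analytic
    ([unif_limit_analytic_at]).

    Derivatives come from the same bound.  The first slope at [w] gives
    [|f' w| <= 2 M / r], hence locally uniform convergence of [f_n] implies that
    of [f_n'] ([weierstrass]); the second slope shows that difference quotients
    converge to [f'] locally uniformly, hence [f'] is itself analytic
    ([analytic_at_derive1]) and one can induct on the order of derivation.

    The maximum principle is also what passes from the boundary to the interior:
    applied to [f_n - f_m], it turns uniform convergence on the boundary into a
    uniform Cauchy condition on the closure.  It is proved by looking, at a point
    where [|f|] is locally maximal, at the first nonzero coefficient
    [a_m] ([m >= 1]) of the expansion: moving in the direction of an [m]-th root
    of [a_0 / a_m] would increase [|f|].  Hence the set where the maximum over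
    the closure is reached, if it avoided the boundary, would be compact and
    open, which is absurd at its point of largest real part. *)

Set Implicit Arguments.
Unset Strict Implicit.
Unset Printing Implicit Defensive.

Import Order.TTheory GRing.Theory Num.Theory numFieldNormedType.Exports.
Import Normc.

Local Open Scope classical_set_scope.
Local Open Scope ring_scope.

(** * The modulus as a real number *)

Section Modulus.
Variable R : realType.
Local Notation C := (Cplx R).
Implicit Types (w x y z : C).

(** The norm of a complex number is a complex number, and the complex order is
    only partial; the real-valued modulus makes real arithmetic available. *)
Definition cmod (z : C) : R := normc z.

Lemma norm_cmod (z : C) : `|z| = (cmod z)%:C%C :> C.
Proof. by []. Qed.

Lemma cmod0 : cmod 0 = 0.
Proof. exact: normc0. Qed.

Lemma cmod1 : cmod 1 = 1.
Proof. exact: normc1. Qed.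

Lemma cmod_ge0 z : 0 <= cmod z.
Proof. by case: z => a b; rewrite sqrtr_ge0. Qed.

Lemma cmodM x y : cmod (x * y) = cmod x * cmod y.
Proof. exact: normcM. Qed.

Lemma cmodD x y : cmod (x + y) <= cmod x + cmod y.
Proof. exact: le_normcD. Qed.

Lemma cmodN x : cmod (- x) = cmod x.
Proof. exact: normcN. Qed.

Lemma cmodV x : cmod x^-1 = (cmod x)^-1.
Proof. exact: normcV. Qed.

Lemma cmod_eq0 x : (cmod x == 0) = (x == 0).
Proof. by apply/eqP/eqP=> [/eq0_normc//|->]; exact: cmod0. Qed.

Lemma cmodX x n : cmod (x ^+ n) = cmod x ^+ n.
Proof. by elim: n => [|n IH]; rewrite ?expr0 ?cmod1// !exprS cmodM IH. Qed.

Lemma cmod_real (x : R) : cmod (x%:C%C) = `|x|.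
Proof. by rewrite /cmod /= expr0n /= addr0 sqrtr_sqr. Qed.

Lemma cmodB_le x y z : cmod (x - z : C) <= cmod (x - y) + cmod (y - z).
Proof. by rewrite -[x - z](_ : x - y + (y - z) = _) ?cmodD// addrA subrK. Qed.

Lemma cmodBC x y : cmod (x - y : C) = cmod (y - x).
Proof. by rewrite -cmodN opprB. Qed.

Lemma cmod_dist (x y : C) : `|cmod x - cmod y| <= cmod (x - y).
Proof.
have h1 : cmod x <= cmod (x - y) + cmod y by have := cmodB_le x y 0; rewrite !subr0.
have h2 : cmod y <= cmod (x - y) + cmod x.
  by have := cmodB_le y x 0; rewrite !subr0 (cmodBC y).
by rewrite ler_norml; apply/andP; split; lra.
Qed.

Lemma cmod_Re z : `|complex.Re z| <= cmod z.
Proof. by have := normc_ge_Re (z : R[i]); rewrite lecR. Qed.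

Lemma cmod_ReIm (x y : R) : cmod (x +i* y)%C <= `|x| + `|y|.
Proof.
have -> : (x +i* y)%C = (x%:C + (0 +i* y))%C by rewrite /= ; simpc.
apply: (le_trans (cmodD _ _)); rewrite cmod_real lerD2l.
by rewrite /cmod /= expr0n /= add0r sqrtr_sqr.
Qed.

Lemma cmod_Im z : `|complex.Im z| <= cmod z.
Proof.
case: z => x y /=; rewrite -sqrtr_sqr ler_wsqrtr// lerDr sqr_ge0 //.
Qed.

Lemma nbhs_cmodP (z : C) (A : set C) :
  nbhs z A <-> exists2 e : R, 0 < e & forall w, cmod (w - z) < e -> A w.
Proof.
split.
  move=> /nbhs_ballP[e /= e0 zA].
  exists (complex.Re e); first by move: e0; rewrite ltcE => /andP[].
  move=> w wz; apply: zA; rewrite -ball_normE /= distrC norm_cmod.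
  move: e0 wz; case: (e) => a b; rewrite !ltcE /= => /andP[/eqP -> _] ->.
  by rewrite eqxx.
move=> [e e0 zA]; apply/nbhs_ballP; exists (e%:C%C : C); first by rewrite /= ltcR.
by move=> w; rewrite -ball_normE /= distrC norm_cmod ltcR; exact: zA.
Qed.

Lemma cvg_cmodP T (F : set_system T) (f : T -> C) (l : C) : Filter F ->
  f @ F --> l <-> forall e : R, 0 < e -> \forall x \near F, cmod (f x - l) < e.
Proof.
move=> FF; split=> H.
  move=> e e0; apply: (H [set w | cmod (w - l) < e]).
  by apply/nbhs_cmodP; exists e.
move=> A /nbhs_cmodP[e e0 eA]; near do apply: eA.
exact: H.
Unshelve. all: by end_near. Qed.

End Modulus.

(** * Geometric Taylor bounds *)

Section Taylor.
Variable R : realType.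
Local Notation C := (Cplx R).
Implicit Types (f g : C -> C) (w x y z : C) (rho B r M : R) (a : nat -> C).

Lemma geometric_small (B q e : R) : 0 <= q < 1 -> 0 < e ->
  \forall n \near \oo, B * q ^+ n < e.
Proof.
move=> /andP[q0 q1] e0.
have /cvgrPdist_lt/(_ _ e0) : B * q ^+ n @[n --> \oo] --> B * 0.
  by apply: cvgM; [exact: cvg_cst|apply: cvg_expr; rewrite ger0_norm].
apply: filterS => n; rewrite mulr0 sub0r normrN; exact/le_lt_trans/ler_norm.
Qed.

(** Used to see that a quantity bounded by all Taylor remainders vanishes. *)
Lemma geometric_le0 (x B q : R) : 0 <= q < 1 -> (forall n, x <= B * q ^+ n) ->
  x <= 0.
Proof.
move=> q01 xB; apply/ler_addgt0Pr => e e0; rewrite add0r.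
have [n _ /(_ n (leqnn n))/= Bn] := geometric_small B q01 e0.
exact: le_trans (xB n) (ltW Bn).
Qed.

Definition psum a z n : C := \sum_(0 <= k < n) a k * z ^+ k.

Lemma psum0 a z : psum a z 0 = 0.
Proof. by rewrite /psum big_geq. Qed.

Lemma psumS a z n : psum a z n.+1 = psum a z n + a n * z ^+ n.
Proof. by rewrite /psum big_nat_recr. Qed.

Lemma psumSl a z n : psum a z n.+1 = a 0%N + z * psum (a \o S) z n.
Proof.
rewrite /psum big_nat_recl // expr0 mulr1; congr (_ + _).
by rewrite mulr_sumr; apply: eq_bigr => i _ /=; rewrite exprS mulrCA.
Qed.

(** A bound on every Taylor remainder at once, by a geometric progression.  Its
    existence amounts to [f] being the sum of a power series near [w], but it
    involves no limit, so that sums, quotients and uniform limits reduce to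
    inequalities. *)
Definition taylor f w rho B a := forall n z, cmod z < rho ->
  cmod (f (w + z) - psum a z n) <= B * (cmod z / rho) ^+ n.

Definition analytic_at f w := exists rho B a, 0 < rho /\ taylor f w rho B a.

Lemma taylor_ge0 f w rho B a : 0 < rho -> taylor f w rho B a -> 0 <= B.
Proof.
move=> r0 /(_ 0%N 0); rewrite cmod0 expr0 mulr1 => /(_ r0); exact/le_trans/cmod_ge0.
Qed.

Lemma taylor_value f w rho B a : 0 < rho -> taylor f w rho B a -> a 0%N = f w.
Proof.
move=> r0 /(_ 1%N 0); rewrite cmod0 mul0r expr1 mulr0 psumSl mul0r !addr0 => /(_ r0).
move=> h; apply/esym/eqP; rewrite -subr_eq0 -cmod_eq0.
by rewrite eq_le h cmod_ge0.
Qed.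

(** The [n]-th term is the difference of two consecutive remainders; it is
    evaluated at distance [rho / 2], and the powers of 2 cancel. *)
Lemma taylor_coef f w rho B a n : 0 < rho -> taylor f w rho B a ->
  cmod (a n) * rho ^+ n <= 2 * B.
Proof.
move=> r0 T.
have B0 := taylor_ge0 r0 T.
pose z : C := (rho / 2)%:C%C.
have zE : cmod z = rho / 2 by rewrite cmod_real ger0_norm// ltW// divr_gt0.
have zr : cmod z < rho by rewrite zE; lra.
have zq : cmod z / rho = 2^-1 by rewrite zE mulrAC divff ?mul1r ?gt_eqF.
have := T n z zr; have := T n.+1 z zr; rewrite psumS zq exprS.
set p := 2^-1 ^+ n => h1 h2.
have p0 : 0 < p by rewrite exprn_gt0 // invr_gt0.
have : cmod (a n * z ^+ n) <= B * (2^-1 * p) + B * p.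
  rewrite -[a n * _](_ : psum a z n + a n * z ^+ n - psum a z n = _); last by rewrite addrC addKr.
  apply: (le_trans (cmodB_le _ (f (w + z)) _)).
  by rewrite cmodBC; apply: lerD.
rewrite cmodM cmodX zE exprMn -/p mulrA -(ler_pM2r p0) => h.
have : cmod (a n) * rho ^+ n * p <= 2 * B * p by nra.
by rewrite ler_pM2r.
Qed.

Lemma taylor_shrink f w rho sigma B a : 0 < sigma -> sigma <= rho ->
  taylor f w rho B a -> taylor f w sigma B a.
Proof.
move=> s0 sr T n z zs.
have r0 : 0 < rho by exact: lt_le_trans s0 sr.
apply: (le_trans (T n z (lt_le_trans zs sr))).
apply: ler_wpM2l; first exact: taylor_ge0 r0 T.
have [s0' r0'] := (ltW s0, ltW r0).
apply: lerXn2r; rewrite ?nnegrE ?divr_ge0 ?cmod_ge0//.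
by apply: ler_wpM2l; rewrite ?cmod_ge0 // lef_pV2.
Qed.

Lemma psumB a b z n : psum (fun k => a k - b k) z n = psum a z n - psum b z n.
Proof. by rewrite /psum -sumrB; apply: eq_bigr => i _; rewrite mulrBl. Qed.

Lemma analytic_at_congr f g w : (\forall z \near w, f z = g z) ->
  analytic_at f w -> analytic_at g w.
Proof.
move=> /nbhs_cmodP[e e0 fg] [rho [B [a [r0 T]]]].
have m0 : 0 < Num.min e rho by rewrite lt_min e0.
exists (Num.min e rho), B, a; split => // n z zm.
rewrite -fg; last by rewrite addrAC subrr add0r (lt_le_trans zm)// ge_min lexx.
by apply: (taylor_shrink m0 _ T) => //; rewrite ge_min lexx orbT.
Qed.

Lemma analytic_atB f g w : analytic_at f w -> analytic_at g w ->
  analytic_at (fun z => f z - g z) w.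
Proof.
move=> [r [B [a [r0 Tf]]]] [r' [B' [a' [r'0 Tg]]]].
have m0 : 0 < Num.min r r' by rewrite lt_min r0.
exists (Num.min r r'), (B + B'), (fun k => a k - a' k); split => // n z zm.
have {}Tf : taylor f w (Num.min r r') B a.
  by apply: taylor_shrink Tf => //; rewrite ge_min lexx.
have {}Tg : taylor g w (Num.min r r') B' a'.
  by apply: taylor_shrink Tg => //; rewrite ge_min lexx orbT.
rewrite psumB mulrDl.
have -> : f (w + z) - g (w + z) - (psum a z n - psum a' z n) =
  (f (w + z) - psum a z n) - (g (w + z) - psum a' z n) by ring.
by apply: (le_trans (cmodD _ _)); rewrite cmodN lerD// ?Tf ?Tg.
Qed.

Lemma analytic_at_cst (c : C) w : analytic_at (fun=> c) w.
Proof.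
exists 1, (cmod c), (fun k => if k is 0%N then c else 0); split => // -[|n] z z1.
  by rewrite psum0 subr0 expr0 mulr1.
rewrite psumSl /psum big1 ?mulr0 ?addr0 ?subrr ?cmod0; last by move=> i _; rewrite mul0r.
by rewrite mulr_ge0 ?exprn_ge0 ?divr_ge0 ?cmod_ge0.
Qed.

Lemma analytic_atZ c f w : analytic_at f w -> analytic_at (fun z => c * f z) w.
Proof.
move=> [r [B [a [r0 T]]]]; exists r, (cmod c * B), (fun k => c * a k); split => // n z zr.
have -> : psum (fun k => c * a k) z n = c * psum a z n.
  by rewrite /psum mulr_sumr; apply: eq_bigr => i _; rewrite mulrA.
by rewrite -mulrBr cmodM -mulrA ler_wpM2l ?cmod_ge0// T.
Qed.

Lemma analytic_at_shift f h w : analytic_at f (w + h) -> analytic_at (fun z => f (z + h)) w.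
Proof.
by move=> [r [B [a [r0 T]]]]; exists r, B, a; split => // n z zr; rewrite addrAC T.
Qed.

End Taylor.

(** * Derivatives and slopes *)

Section Slopes.
Variable R : realType.
Local Notation C := (Cplx R).
Implicit Types (f g : C -> C) (w x y z : C) (rho B r M : R) (a : nat -> C).

Lemma taylor_lipschitz f w rho B a z : 0 < rho -> taylor f w rho B a ->
  cmod z < rho -> cmod (f (w + z) - f w) <= B / rho * cmod z.
Proof.
move=> r0 T zr; have := T 1%N z zr.
by rewrite psumSl (taylor_value r0 T) psum0 mulr0 addr0 expr1 mulrCA mulrC.
Qed.

(** The remainder of order 2 is quadratic, hence the derivative is [a 1]. *)
Lemma taylor_diff f w rho B a z : 0 < rho -> taylor f w rho B a ->
  cmod z < rho -> cmod (f (w + z) - f w - a 1%N * z) <= B / rho ^+ 2 * cmod z ^+ 2.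
Proof.
move=> r0 T zr; have := T 2%N z zr.
rewrite !psumS psum0 add0r expr0 mulr1 expr1 (taylor_value r0 T) opprD addrA.
by rewrite expr_div_n mulrA mulrAC.
Qed.

Lemma analytic_at_continuous f w : analytic_at f w -> {for w, continuous f}.
Proof.
move=> [rho [B [a [r0 T]]]]; apply/(@cvg_cmodP _ _ (nbhs w) f (f w) _).2 => e e0.
have B0 := taylor_ge0 r0 T.
have K0 : 0 < B / rho + 1 by rewrite ltr_wpDl// divr_ge0// ltW.
apply/(nbhs_cmodP _ _).2; exists (Num.min rho (e / (B / rho + 1))).
  by rewrite lt_min r0 divr_gt0.
move=> z; rewrite lt_min => /andP[zr ze].
have := taylor_lipschitz r0 T zr; rewrite [w + _]addrC subrK => h.
apply: (le_lt_trans h); rewrite ltr_pdivlMr// in ze.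
apply: le_lt_trans ze; rewrite mulrDr mulr1 mulrC lerDl; exact: cmod_ge0.
Qed.

Lemma taylor_derive f w rho B a : 0 < rho -> taylor f w rho B a ->
  h^-1 *: (f (h + w) - f w) @[h --> 0^'] --> a 1%N.
Proof.
move=> r0 T; have B0 := taylor_ge0 r0 T.
apply/cvg_cmodP => e e0.
set K := B / rho ^+ 2 + 1.
have K0 : 0 < K by rewrite ltr_wpDl// divr_ge0// exprn_ge0// ltW.
apply/(nbhs_cmodP _ _).2; exists (Num.min rho (e / K)).
  by rewrite lt_min r0 divr_gt0.
move=> h; rewrite subr0 lt_min => /andP[hr he] h0.
have c0 : 0 < cmod h by rewrite lt_neqAle cmod_ge0 eq_sym cmod_eq0 h0.
rewrite /= [h + w]addrC.
have H := taylor_diff r0 T hr.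
have -> : h^-1 *: (f (w + h) - f w) - a 1%N = h^-1 * (f (w + h) - f w - a 1%N * h).
  by rewrite mulrBr [RHS]addrC mulrCA mulVf// mulr1 addrC.
rewrite cmodM cmodV mulrC ltr_pdivrMr//; apply: (le_lt_trans H).
rewrite ltr_pdivlMr// mulrC in he.
have := @mulr_gt0 _ _ _ c0 c0; rewrite /K in he *; nra.
Qed.

Lemma derive1_taylor f w rho B a : 0 < rho -> taylor f w rho B a ->
  derive1 f w = a 1%N.
Proof.
by move=> r0 T; apply/cvg_lim; [exact: norm_hausdorff|exact: taylor_derive T].
Qed.

Lemma cvg_derive1 f w : analytic_at f w ->
  h^-1 *: (f (h + w) - f w) @[h --> 0^'] --> derive1 f w.
Proof.
move=> [rho [B [a [r0 T]]]]; rewrite (derive1_taylor r0 T).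
exact: taylor_derive T.
Qed.

Lemma derive1B f g w : analytic_at f w -> analytic_at g w ->
  derive1 (fun z => f z - g z) w = derive1 f w - derive1 g w.
Proof.
move=> /cvg_derive1 cf /cvg_derive1 cg; apply/cvg_lim; first exact: norm_hausdorff.
apply: cvg_trans (cvgB cf cg); apply: near_eq_cvg; near=> h.
rewrite -[LHS]/(h^-1 * _ - h^-1 * _) -[RHS]/(h^-1 * _) -mulrBr.
by congr (_ * _); ring.
Unshelve. all: by end_near. Qed.

(** At [w] the slope is completed by its limit, so that it stays analytic there. *)
Definition dslope w f z := if z == w then derive1 f w else (f z - f w) / (z - w).

Lemma dslope_eq w f : dslope w f w = derive1 f w.
Proof. by rewrite /dslope eqxx. Qed.

Lemma dslopeE w f z : f z = f w + (z - w) * dslope w f z.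
Proof.
rewrite /dslope; case: eqVneq => [->|zw]; first by rewrite subrr mul0r addr0.
by rewrite mulrC divfK ?subr_eq0// addrC subrK.
Qed.

(** At the centre, the slope has the shifted coefficients [a_(k+1)]. *)
Lemma analytic_at_dslope_center f w : analytic_at f w -> analytic_at (dslope w f) w.
Proof.
move=> [rho [B [a [r0 T]]]]; have B0 := taylor_ge0 r0 T.
exists rho, (2 * B / rho), (a \o S); split=> // n z zr.
have [->|z0] := eqVneq z 0.
  rewrite addr0 dslope_eq (derive1_taylor r0 T) cmod0 mul0r.
  case: n => [|n]; last first.
    by rewrite psumSl mul0r addr0 subrr cmod0 expr0n mulr0.
  rewrite psum0 subr0 expr0 mulr1 ler_pdivlMr//.
  by have := taylor_coef 1 r0 T; rewrite expr1.
have c0 : 0 < cmod z by rewrite lt_neqAle cmod_ge0 eq_sym cmod_eq0 z0.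
have := T n.+1 z zr; rewrite psumSl (taylor_value r0 T) => {}T.
rewrite opprD addrA in T; rewrite -(ler_pM2l c0) -cmodM mulrBr.
have -> : z * dslope w f (w + z) = f (w + z) - f w.
  by rewrite (dslopeE w f (w + z)) [RHS]addrAC subrr add0r addrAC subrr add0r.
apply: (le_trans T); rewrite exprS.
rewrite [leRHS](_ : _ = 2 * (B * (cmod z / rho * (cmod z / rho) ^+ n))); last by ring.
rewrite ler_peMl ?ler1n// mulr_ge0//.
by rewrite mulr_ge0 ?exprn_ge0 ?divr_ge0 ?cmod_ge0// ltW.
Qed.

(** The coefficients of the quotient by [z + d] of the power series in [z] with
    coefficients [a]: they solve [d c_0 = a_0], [d c_(n+1) + c_n = a_(n+1)]. *)
Fixpoint divcoef (d : C) a n : C :=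
  (a n - if n is m.+1 then divcoef d a m else 0) / d.

(** Multiplying back by [z + d] telescopes: only one extra term is left. *)
Lemma psum_divcoef d a z n : d != 0 ->
  (z + d) * psum (divcoef d a) z n.+1 =
  psum a z n.+1 + divcoef d a n * z ^+ n.+1.
Proof.
move=> d0; elim: n => [|n IH].
  rewrite !psumS !psum0 !add0r expr0 !mulr1 expr1 /= subr0.
  by rewrite mulrDl mulrC [d * _]mulrC divfK// addrC.
rewrite psumS mulrDr IH (psumS a z n.+1) -!addrA; congr (_ + _).
by rewrite [divcoef d a n.+1]/= !exprS; field.
Qed.

(** The recursion divides by [d] with [rho <= |d| / 2], so the previous
    coefficient contributes at most half of the bound, which thus propagates. *)
Lemma divcoef_bound d a rho K n : 0 < rho -> 2 * rho <= cmod d ->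
  (forall n, cmod (a n) * rho ^+ n <= K) ->
  cmod (divcoef d a n) * rho ^+ n <= 2 * K / cmod d.
Proof.
move=> r0 rd aK.
have d0 : 0 < cmod d by apply: lt_le_trans rd; rewrite mulr_gt0.
have K0 : 0 <= K by apply: le_trans (aK 0%N); rewrite expr0 mulr1 cmod_ge0.
rewrite ler_pdivlMr// mulrAC.
elim: n => [|n IH].
  rewrite /= subr0 expr0 mulr1 cmodM cmodV divfK ?gt_eqF//.
  have := aK 0%N; rewrite expr0 mulr1; lra.
rewrite /= cmodM cmodV divfK ?gt_eqF//.
have h : cmod (a n.+1 - divcoef d a n) <= cmod (a n.+1) + cmod (divcoef d a n).
  by apply: (le_trans (cmodD _ _)); rewrite cmodN.
have rn : 0 <= rho ^+ n.+1 by rewrite exprn_ge0// ltW.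
apply: (le_trans (ler_wpM2r rn h)); rewrite mulrDl.
have := aK n.+1; suff : cmod (divcoef d a n) * rho ^+ n.+1 <= K by lra.
rewrite exprS.
have : 0 <= cmod (divcoef d a n) * rho ^+ n by rewrite mulr_ge0 ?cmod_ge0// exprn_ge0// ltW.
rewrite mulrAC in IH; rewrite mulrCA.
set p := _ * rho ^+ n in IH * => p0; nra.
Qed.

(** Within half the distance to [z0] the denominator stays at least [|d| / 2] in
    modulus, and [divcoef_bound] controls the coefficients of the quotient. *)
Lemma analytic_at_div f w z0 : w != z0 -> analytic_at f w ->
  analytic_at (fun z => f z / (z - z0)) w.
Proof.
move=> wz [rho [B [a [r0 T]]]]; set d := w - z0.
have d0 : d != 0 by rewrite subr_eq0.
have cd : 0 < cmod d by rewrite lt_neqAle cmod_ge0 eq_sym cmod_eq0 d0.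
pose s := Num.min rho (cmod d / 2).
have s0 : 0 < s by rewrite lt_min r0 divr_gt0.
have {}T : taylor f w s B a by apply: (taylor_shrink s0 _ T); rewrite ge_min lexx.
have sd : 2 * s <= cmod d.
  have : s <= cmod d / 2 by rewrite ge_min lexx orbT.
  lra.
have B0 := taylor_ge0 s0 T.
have cB n := divcoef_bound n s0 sd (fun n => taylor_coef n s0 T).
set K := 2 * _ / _ in cB.
have K0 : 0 <= K by rewrite !mulr_ge0// invr_ge0 cmod_ge0.
exists s, ((B + K * s) / (cmod d / 2)), (divcoef d a); split => // n z zs.
have zd : cmod d / 2 <= cmod (z + d).
  have : cmod d <= cmod (z + d) + cmod z.
    by rewrite -[in leLHS](addKr z d) addrC -(cmodN z) cmodD.
  by lra.
have zd0 : z + d != 0 by rewrite -cmod_eq0 gt_eqF//; apply: lt_le_trans zd; rewrite divr_gt0.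
have q0 : 0 <= cmod z / s by rewrite divr_ge0 ?cmod_ge0// ltW.
suff num : cmod (f (w + z) - (z + d) * psum (divcoef d a) z n) <=
    (B + K * s) * (cmod z / s) ^+ n.
  rewrite [w + z - z0]addrAC -/d [d + z]addrC.
  rewrite -[psum _ _ _](mulKf zd0) [f _ / _]mulrC -mulrBr cmodM cmodV.
  rewrite mulrC [leRHS]mulrAC; apply: ler_pM; rewrite ?cmod_ge0 ?invr_ge0 ?cmod_ge0//.
  by rewrite lef_pV2// posrE ?divr_gt0//; apply: lt_le_trans zd; rewrite divr_gt0.
case: n => [|n].
  have := T 0%N z zs; rewrite !psum0 mulr0 !expr0 !mulr1 => /le_trans; apply.
  by rewrite lerDl mulr_ge0// ltW.
rewrite psum_divcoef// opprD addrA; apply: (le_trans (cmodD _ _)); rewrite cmodN mulrDl.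
apply: lerD; first exact: T.
rewrite cmodM cmodX exprMn exprVn exprS [s ^+ _]exprS.
have sn : 0 < s ^+ n by rewrite exprn_gt0.
rewrite [leRHS](_ : _ = K / s ^+ n * (cmod z * cmod z ^+ n)); last by field; rewrite !gt_eqF.
by rewrite ler_wpM2r ?mulr_ge0 ?exprn_ge0 ?cmod_ge0// ler_pdivlMr.
Qed.

Lemma analytic_at_dslope w f z : analytic_at f w -> analytic_at f z ->
  analytic_at (dslope w f) z.
Proof.
have [->|zw] := eqVneq z w; first by move=> + _; exact: analytic_at_dslope_center.
move=> _ fz; have := analytic_at_div zw (analytic_atB fz (analytic_at_cst (f w) z)).
apply: analytic_at_congr; apply/nbhs_cmodP; exists (cmod (z - w)).
  by rewrite lt_neqAle cmod_ge0 eq_sym cmod_eq0 subr_eq0 zw.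
move=> x xz; rewrite /dslope; case: eqVneq xz => // ->.
by rewrite cmodBC ltxx.
Qed.

End Slopes.

(** * Compactness in the plane *)

Section Compactness.
Variable R : realType.
Local Notation C := (Cplx R).
Implicit Types (f g : C -> C) (w x y z : C) (rho B r M : R) (a : nat -> C).

Lemma continuous_complex : continuous (fun p : R * R => (p.1 +i* p.2)%C : C).
Proof.
move=> [x y]; apply/(@cvg_cmodP _ _ (nbhs (x, y)) _ _ _).2 => e e0.
have e2 : 0 < e / 2 by rewrite divr_gt0.
near=> p.
have -> : ((p.1 +i* p.2)%C : C) - (x +i* y)%C = ((p.1 - x) +i* (p.2 - y))%C by simpc.
apply: (le_lt_trans (cmod_ReIm _ _)); rewrite [e]splitr; apply: ltrD.
  near: p; exists (ball x (e / 2), setT) => /=.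
    by split; [exact: nbhsx_ballx|exact: filterT].
  by move=> [p1 p2] /= [+ _]; rewrite /ball /= distrC.
near: p; exists (setT, ball y (e / 2)) => /=.
  by split; [exact: filterT|exact: nbhsx_ballx].
by move=> [p1 p2] /= [_ +]; rewrite /ball /= distrC.
Unshelve. all: by end_near. Qed.

(** The plane is a continuous image of the product of two real lines. *)
Lemma bounded_closed_compact_cplx (A : set C) (N : R) :
  (forall z, A z -> cmod z <= N) -> closed A -> compact A.
Proof.
move=> AN Acl.
have sq : compact (`[- N, N]%classic `*` `[- N, N]%classic : set (R * R)).
  by apply: compact_setX; exact: segment_compact.
have img := continuous_compact (continuous_subspaceT continuous_complex) sq.
apply: (subclosed_compact Acl img) => -[x y] /AN xyN.
exists (x, y) => //=; rewrite !in_itv /= -!ler_norml.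
by rewrite (le_trans (cmod_Re (x +i* y)%C))// (le_trans (cmod_Im (x +i* y)%C)).
Qed.

Lemma within_continuousP (A : set C) f :
  {within A, continuous f} <-> forall z, A z -> forall e : R, 0 < e ->
    \forall x \near z, A x -> cmod (f x - f z) < e.
Proof.
split=> [/subspace_continuousP cf z Az e e0|cf].
  by have /cvg_cmodP := cf z Az; exact.
apply/subspace_continuousP => z Az; apply/cvg_cmodP => e e0; exact: cf.
Qed.

Lemma within_continuous_cmod (A : set C) f : {within A, continuous f} ->
  {within A, continuous (fun z => cmod (f z))}.
Proof.
move=> /within_continuousP cf; apply/subspace_continuousP => z Az.
apply/cvgrPdist_lt => e e0; have := cf z Az e e0.
apply: filterS => x /[apply]; apply: le_lt_trans => /=.
by rewrite cmodBC; exact: cmod_dist.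
Qed.

Lemma compact_max_cplx (A : set C) (phi : C -> R) : A !=set0 -> compact A ->
  {within A, continuous phi} ->
  exists2 c, A c & forall z, A z -> phi z <= phi c.
Proof.
move=> A0 cA cphi; have [c /set_mem Ac cmax] := compact_EVT_max A0 cA cphi.
by exists c => // z Az; apply: cmax; exact: mem_set.
Qed.

End Compactness.

(** * The maximum principle *)

Section MaximumPrinciple.
Variable R : realType.
Local Notation C := (Cplx R).
Implicit Types (f g : C -> C) (w x y z : C) (rho B r M : R) (a : nat -> C).

(** With [u^(m+1) = f w / a_(m+1)] and [z = t u], the first two terms add up to
    [(1 + t^(m+1)) f w], a gain in modulus of order [t^(m+1)], while the remainder
    is of order [t^(m+2)]; a small [t] wins. *)
Lemma modulus_not_maximal f w rho B a m (e : R) : 0 < rho -> taylor f w rho B a ->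
  f w != 0 -> a m.+1 != 0 -> (forall k, (k < m)%N -> a k.+1 = 0) -> 0 < e ->
  exists2 z, cmod z < e & cmod (f w) < cmod (f (w + z)).
Proof.
move=> r0 T fw0 am0 ak0 e0.
have B0 := taylor_ge0 r0 T.
have gt0c (x : C) : x != 0 -> 0 < cmod x.
  by move=> x0; rewrite lt_neqAle cmod_ge0 eq_sym cmod_eq0 x0.
pose u : C := m.+1.-root (f w / a m.+1).
have um : u ^+ m.+1 = f w / a m.+1 by rewrite rootCK.
have u0 : u != 0 by rewrite rootC_eq0// mulf_neq0// invr_neq0.
pose L := B * (cmod u / rho) ^+ m.+2.
have L0 : 0 <= L by rewrite mulr_ge0// exprn_ge0// divr_ge0 ?cmod_ge0// ltW.
pose t := Num.min (Num.min rho e / (2 * cmod u)) (cmod (f w) / (2 * (L + 1))).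
have cu := gt0c _ u0; have cf := gt0c _ fw0.
have m0 : 0 < Num.min rho e by rewrite lt_min r0.
have L1 : 0 < L + 1 by rewrite ltr_wpDl.
have t0 : 0 < t by rewrite lt_min !divr_gt0 ?mulr_gt0.
have tu : t * cmod u < Num.min rho e.
  have : t <= Num.min rho e / (2 * cmod u) by rewrite ge_min lexx.
  by rewrite ler_pdivlMr ?mulr_gt0//; lra.
have tL : L * t < cmod (f w).
  have : t <= cmod (f w) / (2 * (L + 1)) by rewrite ge_min lexx orbT.
  by rewrite ler_pdivlMr ?mulr_gt0//; lra.
pose z : C := t%:C%C * u.
have cz : cmod z = t * cmod u by rewrite cmodM cmod_real gtr0_norm.
exists z; first by rewrite cz (lt_le_trans tu)// ge_min lexx orbT.
have zr : cmod z < rho by rewrite cz (lt_le_trans tu)// ge_min lexx.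
have := T m.+2 z zr; rewrite psumS psumSl.
rewrite [psum _ z m](_ : _ = 0); last first.
  by rewrite /psum big_nat_cond big1// => k /andP[/andP[_ km] _] /=; rewrite ak0 ?mul0r.
rewrite mulr0 addr0 (taylor_value r0 T).
have -> : a m.+1 * z ^+ m.+1 = (t ^+ m.+1)%:C%C * f w.
  by rewrite exprMn um rmorphXn /= mulrCA [a _ * _]mulrC divfK.
have -> : f w + (t ^+ m.+1)%:C%C * f w = (1 + t ^+ m.+1)%:C%C * f w.
  by rewrite rmorphD rmorph1 mulrDl mul1r.
move=> h.
have := cmodB_le ((1 + t ^+ m.+1)%:C%C * f w) (f (w + z)) 0.
have tm : 0 < t ^+ m.+1 by rewrite exprn_gt0.
rewrite !subr0 cmodM cmod_real ger0_norm ?addr_ge0// ?(ltW tm)// cmodBC => h2.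
have h3 : B * (cmod z / rho) ^+ m.+2 = L * t * t ^+ m.+1.
  by rewrite /L cz -[t * cmod u / rho]mulrA exprMn [t ^+ m.+2]exprS; ring.
rewrite h3 in h.
have : L * t * t ^+ m.+1 < cmod (f w) * t ^+ m.+1 by rewrite ltr_pM2r.
lra.
Qed.

(** If [f w = 0], then [f] vanishes nearby.  Otherwise either all coefficients of
    positive index vanish, or the first nonzero one yields larger values of [|f|]
    arbitrarily close to [w]. *)
Lemma modulus_max_locally_constant f w (e : R) : analytic_at f w -> 0 < e ->
  (forall z, cmod (z - w) < e -> cmod (f z) <= cmod (f w)) ->
  \forall z \near w, f z = f w.
Proof.
move=> [rho [B [a [r0 T]]]] e0 fmax.
have [fw0|fw0] := eqVneq (f w) 0.
  apply/(nbhs_cmodP _ _).2; exists e => // z /fmax.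
  rewrite fw0 cmod0 => fz0; apply/eqP; rewrite -cmod_eq0.
  by rewrite eq_le fz0 cmod_ge0.
have [[k ak]|a0] := pselect (exists k, a k.+1 != 0).
  have [m am mmin] := ex_minnP (ex_intro (fun k => a k.+1 != 0) k ak).
  have [|z ze] := modulus_not_maximal r0 T fw0 am _ e0.
    move=> j jm; apply/eqP/negPn/negP => /mmin; by rewrite leqNgt jm.
  by rewrite ltNge => /negP[]; apply: fmax; rewrite addrAC subrr add0r.
apply/(nbhs_cmodP _ _).2; exists rho => // z zr; apply/eqP.
rewrite -subr_eq0 -cmod_eq0 eq_le cmod_ge0 andbT.
have q1 : cmod (z - w) / rho < 1 by rewrite ltr_pdivrMr// mul1r.
have q0 : 0 <= cmod (z - w) / rho by rewrite divr_ge0 ?cmod_ge0// ltW.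
apply: (@geometric_le0 _ _ (B * (cmod (z - w) / rho)) (cmod (z - w) / rho)); first by rewrite q0.
move=> n; have := T n.+1 _ zr; rewrite psumSl (taylor_value r0 T).
rewrite /psum big1 ?mulr0 ?addr0; last first.
  move=> i _ /=; have [->|ai] := eqVneq (a i.+1) 0; first by rewrite mul0r.
  by case: a0; exists i.
by rewrite [w + _]addrC subrK exprS mulrA.
Qed.

(** Let [K] be the set of points of the closure where [|f|] is maximal.  If the
    maximum exceeded [M], the compact set [K] would lie in [U], hence be open by
    [modulus_max_locally_constant]; this contradicts the existence in [K] of a
    point of largest real part. *)
Lemma maximum_principle (U : set C) f (N M : R) :
  open U -> (forall z, U z -> cmod z <= N) ->
  (forall z, U z -> analytic_at f z) -> {within closure U, continuous f} ->
  (forall z, closure U z -> ~ U z -> cmod (f z) <= M) ->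
  forall z, closure U z -> cmod (f z) <= M.
Proof.
move=> oU UN fan fc fM z0 Uz0.
have UN' z : closure U z -> cmod z <= N.
  move=> Uz; apply/ler_addgt0Pr => e e0.
  have [x [/UN Ux xz]] : U `&` [set x | cmod (x - z) < e] !=set0.
    by apply: Uz; apply/nbhs_cmodP; exists e.
  have := cmodB_le z x 0; rewrite !subr0 cmodBC => /le_trans; apply.
  by rewrite addrC lerD// ltW.
have cptU : compact (closure U) by apply: (bounded_closed_compact_cplx UN'); exact: closed_closure.
have [c Uc cmax] := compact_max_cplx (ex_intro _ _ Uz0) cptU (within_continuous_cmod fc).
apply: (le_trans (cmax _ Uz0)); rewrite leNgt; apply/negP => Mc.
pose K := [set z | closure U z /\ cmod (f z) = cmod (f c)].
have KU z : K z -> U z.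
  by move=> [Uz fz]; apply: contrapT => nUz; have := fM z Uz nUz; rewrite fz leNgt Mc.
have clK : closed K.
  move=> z Kz.
  have Uz : closure U z by apply: closed_closure; apply: closureS Kz => x [].
  split => //; apply: contrapT => fz.
  have e0 : 0 < `|cmod (f z) - cmod (f c)| by rewrite normr_gt0 subr_eq0; apply/eqP.
  have /Kz[x [[Ux fx] /(_ Ux)]] := (within_continuousP _ _).1 fc z Uz _ e0.
  rewrite -fx ltNge => /negP; apply.
  by rewrite cmodBC; exact: cmod_dist.
have cptK : compact K by apply: (subclosed_compact clK cptU) => z [].
have Re_cont : {within K, continuous (fun z : C => complex.Re z : R)}.
  apply/subspace_continuousP => z Kz; apply/cvgrPdist_lt => e e0.
  apply: cvg_within; apply/(nbhs_cmodP _ _).2; exists e => // x.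
  apply: le_lt_trans => /=; rewrite cmodBC.
  apply: le_trans (cmod_Re _); by case: (x) => ? ?; case: (z) => ? ?.
have [p Kp pmax] := compact_max_cplx (ex_intro _ c (conj Uc erefl)) cptK Re_cont.
have Up := KU p Kp.
have /nbhs_cmodP[e e0 pU] := oU p Up.
have /nbhs_cmodP[d d0 fp] : \forall z \near p, f z = f p.
  apply: (modulus_max_locally_constant (fan p Up) e0) => z /pU Uz.
  by case: Kp => _ ->; apply: cmax; exact: subset_closure.
pose h := Num.min e d / 2.
have m0 : 0 < Num.min e d by rewrite lt_min e0.
have h0 : 0 < h by rewrite divr_gt0.
have hm : h < Num.min e d by rewrite /h; lra.
(* a point of K just to the right of p *)
pose x : C := p + h%:C%C.
have xp : cmod (x - p) < Num.min e d by rewrite /x addrAC subrr add0r cmod_real gtr0_norm.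
have Kx : K x.
  split; first by apply: subset_closure; apply: pU; rewrite (lt_le_trans xp)// ge_min lexx.
  by rewrite fp ?(lt_le_trans xp)// ?ge_min ?lexx ?orbT//; case: Kp.
have := pmax x Kx.
rewrite /x; case: (p) => ? ? /=; lra.
Qed.

End MaximumPrinciple.

(** * Cauchy estimates and locally uniform limits *)

Section CauchyEstimates.
Variable R : realType.
Local Notation C := (Cplx R).
Implicit Types (f g : C -> C) (w x y z : C) (rho B r M : R) (a : nat -> C).

Definition disc w r : set C := [set z | cmod (z - w) <= r].

Lemma disc_center w r : 0 <= r -> disc w r w.
Proof. by rewrite /disc /= subrr cmod0. Qed.

Lemma open_ball w r : open [set z : C | cmod (z - w) < r].
Proof.
rewrite openE => z /= zr; apply/(nbhs_cmodP _ _).2; exists (r - cmod (z - w)).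
  by rewrite subr_gt0.
by move=> x xz /=; have := cmodB_le x z w; lra.
Qed.

Lemma closed_disc w r : closed (disc w r).
Proof.
rewrite -[disc w r]setCK; apply: open_closedC; rewrite openE => z /= /negP.
rewrite -ltNge => zr; apply/(nbhs_cmodP _ _).2; exists (cmod (z - w) - r).
  by rewrite subr_gt0.
move=> x xz /=; apply/negP; rewrite -ltNge.
by have := cmodB_le z x w; rewrite (cmodBC z x); lra.
Qed.

Lemma disc_bounded w r z : disc w r z -> cmod z <= r + cmod w.
Proof. by move=> zr; have := cmodB_le z w 0; rewrite !subr0; have : cmod (z - w) <= r by []; lra. Qed.

Lemma compact_disc w r : compact (disc w r).
Proof.
apply: bounded_closed_compact_cplx (@closed_disc w r) => z; exact: disc_bounded.
Qed.

Lemma analytic_within_continuous (A : set C) f :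
  (forall z, A z -> analytic_at f z) -> {within A, continuous f}.
Proof.
move=> fA; apply/subspace_continuousP => z Az.
by apply: cvg_within_filter; exact: analytic_at_continuous (fA z Az).
Qed.

Lemma analytic_bounded w r f : 0 <= r ->
  (forall z, disc w r z -> analytic_at f z) ->
  exists M, forall z, disc w r z -> cmod (f z) <= M.
Proof.
move=> r0 fan; have cf := within_continuous_cmod (analytic_within_continuous fan).
have [c _ cmax] := compact_max_cplx (ex_intro _ w (disc_center w r0)) (@compact_disc w r) cf.
by exists (cmod (f c)).
Qed.

Lemma dslope_analytic_disc w r f : 0 <= r ->
  (forall z, disc w r z -> analytic_at f z) ->
  forall z, disc w r z -> analytic_at (dslope w f) z.
Proof.
move=> r0 fan z Dz; apply: analytic_at_dslope; apply: fan => //.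
exact: disc_center.
Qed.

(** On the circle the denominator has modulus [r] and the numerator is at most
    [2 M]; the maximum principle extends the bound inside. *)
Lemma dslope_bound w r f M : 0 < r ->
  (forall z, disc w r z -> analytic_at f z) ->
  (forall z, disc w r z -> cmod (f z) <= M) ->
  forall z, disc w r z -> cmod (dslope w f z) <= 2 / r * M.
Proof.
move=> r0 fan fM.
have circle z : cmod (z - w) = r -> cmod (dslope w f z) <= 2 / r * M.
  move=> zr; rewrite /dslope; case: eqVneq zr => [->|zw zr].
    by rewrite subrr cmod0 => r00; move: r0; rewrite -r00 ltxx.
  rewrite cmodM cmodV zr mulrAC ler_pM2r ?invr_gt0//.
  have h1 : cmod (f w) <= M by apply: fM; apply: disc_center; exact: ltW.
  have h2 : cmod (f z) <= M by apply: fM; rewrite /disc /= zr.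
  by apply: (le_trans (cmodD _ _)); rewrite cmodN; lra.
have sub : closure [set z | cmod (z - w) < r] `<=` disc w r.
  rewrite (_ : disc w r = closure (disc w r)).
    by apply: closureS => z /= /ltW.
  by apply/closure_id; exact: closed_disc.
move=> z; rewrite /disc /= le_eqVlt => /orP[/eqP/circle//|zr].
apply: (@maximum_principle _ [set z | cmod (z - w) < r] _ (r + cmod w)) => //.
- exact: open_ball.
- by move=> x xr; apply: disc_bounded; exact: ltW.
- by move=> x xr; apply: (dslope_analytic_disc (ltW r0)) => //; exact: ltW.
- apply: analytic_within_continuous => x /sub xr.
  exact: (dslope_analytic_disc (ltW r0)).
- move=> x /sub xr /negP; rewrite -leNgt => xr'; apply: circle.
  by apply/eqP; rewrite eq_le xr'; move: xr; rewrite /disc /= => ->.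
- exact: subset_closure.
Qed.

Lemma iter_dslope_bound w r f M k : 0 < r ->
  (forall z, disc w r z -> analytic_at f z) ->
  (forall z, disc w r z -> cmod (f z) <= M) ->
  forall z, disc w r z -> analytic_at (iter k (dslope w) f) z /\
    cmod (iter k (dslope w) f z) <= (2 / r) ^+ k * M.
Proof.
move=> r0 fan fM; elim: k => [|k IH] z Dz.
  by rewrite expr0 mul1r; split; [exact: fan|exact: fM].
split; first by apply: (dslope_analytic_disc (ltW r0)) => // x /IH[].
rewrite exprS -mulrA; apply: (dslope_bound r0) => // x /IH[] //.
Qed.

Lemma dslopeB w f g : analytic_at f w -> analytic_at g w ->
  dslope w (fun z => f z - g z) = (fun z => dslope w f z - dslope w g z).
Proof.
move=> fw gw; apply/funext => z; rewrite /dslope; case: eqVneq => [_|zw].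
  exact: derive1B.
by rewrite -mulrBl; congr (_ * _); ring.
Qed.

Lemma iter_dslopeB w f g k : analytic_at f w -> analytic_at g w ->
  iter k (dslope w) (fun z => f z - g z) =
  (fun z => iter k (dslope w) f z - iter k (dslope w) g z).
Proof.
elim: k f g => [//|k IH] f g fw gw.
by rewrite !iterSr dslopeB// IH//; exact: analytic_at_dslope.
Qed.

(** The iterated slopes at [w] are the Taylor coefficients, and the iterated
    slope at [z] gives the exact remainder. *)
Lemma dslope_expansion w f z k :
  f z = psum (fun j => iter j (dslope w) f w) (z - w) k +
        (z - w) ^+ k * iter k (dslope w) f z.
Proof.
elim: k => [|k IH]; first by rewrite psum0 add0r expr0 mul1r.
rewrite psumS -addrA {1}IH; congr (_ + _); rewrite iterS.
rewrite [iter k _ f z](dslopeE w) exprSr; ring.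
Qed.

(** A Cauchy sequence stays in a compact disc, hence has a cluster point, to which
    it converges. *)
Lemma cplx_complete (u : nat -> C) :
  (forall e : R, 0 < e -> exists N, forall n m, (N <= n)%N -> (N <= m)%N ->
     cmod (u n - u m) < e) -> exists l : C, u n @[n --> \oo] --> l.
Proof.
move=> uC; have [N uN] := uC 1 ltr01.
have uD : \forall n \near \oo, disc (u N) 1 (u n).
  by exists N => // n /= Nn; rewrite /disc /= ltW// uN.
have [l [_ lcl]] := @compact_disc (u N) 1 (u @ \oo) _ uD.
exists l; apply/cvg_cmodP => e e0.
have [N' uN'] := uC (e / 2) (divr_gt0 e0 (ltr0Sn _ 1)).
have [x [/= [m /= N'm <-] xl]] : [set x | exists2 m, (N' <= m)%N & u m = x] `&`
    [set x | cmod (x - l) < e / 2] !=set0.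
  apply: lcl; first by exists N' => // n /= N'n; exists n.
  by apply/nbhs_cmodP; exists (e / 2); rewrite ?divr_gt0.
exists N' => // n /= N'n.
by have := cmodB_le (u n) (u m) l; have := uN' n m N'n N'm; move: xl => /=; lra.
Qed.

Lemma cmod_lim_le (u : nat -> C) (l : C) (c : R) :
  (\forall n \near \oo, cmod (u n) <= c) -> u n @[n --> \oo] --> l -> cmod l <= c.
Proof.
move=> uc /cvg_cmodP ul; apply/ler_addgt0Pr => e /ul ue.
have [N _ /(_ N (leqnn N))[/= h1 h2]] := filterI uc ue.
by have := cmodB_le l (u N) 0; rewrite !subr0 cmodBC; lra.
Qed.

Lemma cvg_psum (b : nat -> nat -> C) a z k :
  (forall j, b n j @[n --> \oo] --> a j) ->
  psum (b n) z k @[n --> \oo] --> psum a z k.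
Proof.
move=> ba; elim: k => [|k IH].
  by rewrite psum0; under eq_fun do rewrite psum0; exact: cvg_cst.
rewrite psumS; under eq_fun do rewrite psumS.
exact: cvgD IH (cvgM (ba k) (cvg_cst (z ^+ k))).
Qed.

(** Slopes are linear in the function, so [dslope_bound] makes the [k]-th
    coefficients of the [F n] a Cauchy sequence for each [k].  The limits are the
    coefficients of [f]: the remainder bounds, uniform in [n], pass to the limit. *)
Lemma unif_limit_analytic_at (F : nat -> C -> C) f w r : 0 < r ->
  (forall n z, disc w r z -> analytic_at (F n) z) ->
  (forall e : R, 0 < e -> \forall n \near \oo, forall z, disc w r z ->
     cmod (F n z - f z) < e) ->
  analytic_at f w.
Proof.
move=> r0 Fan Ff.
have Dw : disc w r w by apply: disc_center; exact: ltW.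
have cauchy k (e : R) : 0 < e -> exists N, forall n m, (N <= n)%N -> (N <= m)%N ->
    cmod (iter k (dslope w) (F n) w - iter k (dslope w) (F m) w) < e.
  move=> e0; have p0 : 0 < (2 / r) ^+ k by rewrite exprn_gt0// divr_gt0.
  have e'0 : 0 < e / (2 / r) ^+ k / 4 by rewrite !divr_gt0.
  have [N _ FN] := Ff _ e'0; exists N => n m Nn Nm.
  have := @iter_dslope_bound w r (fun z => F n z - F m z) (e / (2 / r) ^+ k / 2) k r0 _ _ w Dw.
  rewrite iter_dslopeB; [|exact: Fan..]; case.
  - by move=> z Dz; apply: analytic_atB; exact: Fan.
  - move=> z Dz; have := cmodB_le (F n z) (f z) (F m z).
    have := FN n Nn z Dz; have := FN m Nm z Dz; rewrite (cmodBC (f z)); lra.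
  move=> _ /le_lt_trans; apply; set p := _ ^+ k in p0 *.
  by rewrite (_ : p * (e / p / 2) = e / 2); [lra|field; rewrite gt_eqF].
have [a aE] := choice (fun k => cplx_complete (cauchy k)).
have [N _ FN1] := Ff 1 ltr01.
have [M FM] := analytic_bounded (ltW r0) (Fan N).
(* M bounds the N-th function, which is within 2 of all the later ones *)
exists (r / 2), (M + 2), a; split; first by rewrite divr_gt0.
move=> k z zr.
have Dz : disc w r (w + z) by rewrite /disc /= addrAC subrr add0r; lra.
have lim : F n (w + z) - psum (fun j => iter j (dslope w) (F n) w) z k @[n --> \oo] -->
    f (w + z) - psum a z k.
  apply: cvgB; last exact: cvg_psum.
  by apply/cvg_cmodP => e /Ff; apply: filterS => n; exact.
apply: cmod_lim_le lim; exists N => // n /= Nn.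
have FnM x : disc w r x -> cmod (F n x) <= M + 2.
  move=> Dx; have := FM x Dx; have := FN1 n Nn x Dx; have := FN1 N (leqnn N) x Dx.
  have := cmodB_le (F n x) (f x) (F N x); rewrite (cmodBC (f x)).
  have := cmodB_le (F n x) (F N x) 0; rewrite !subr0; lra.
have [_ Dk] := iter_dslope_bound k r0 (Fan n) FnM Dz.
rewrite [F n _](dslope_expansion w _ _ k) [w + z - w]addrAC subrr add0r.
rewrite addrAC subrr add0r cmodM cmodX.
apply: (le_trans (ler_wpM2l _ Dk)); first by rewrite exprn_ge0 ?cmod_ge0.
by rewrite mulrA mulrC -exprMn invfM invrK (mulrC r^-1).
Qed.

Lemma derive1_bound w r f M : 0 < r ->
  (forall z, disc w r z -> analytic_at f z) ->
  (forall z, disc w r z -> cmod (f z) <= M) -> cmod (derive1 f w) <= 2 / r * M.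
Proof.
move=> r0 fan fM; rewrite -dslope_eq; apply: dslope_bound => //.
by apply: disc_center; exact: ltW.
Qed.

(** The difference quotient minus the derivative is exactly [h] times the second
    slope at [w + h]. *)
Lemma difference_quotient_bound w r f M h : 0 < r ->
  (forall z, disc w r z -> analytic_at f z) ->
  (forall z, disc w r z -> cmod (f z) <= M) -> h != 0 -> cmod h <= r ->
  cmod (h^-1 * (f (w + h) - f w) - derive1 f w) <= cmod h * ((2 / r) ^+ 2 * M).
Proof.
move=> r0 fan fM h0 hr.
have Dh : disc w r (w + h) by rewrite /disc /= addrAC subrr add0r.
have [_ b] := iter_dslope_bound 2 r0 fan fM Dh.
have := dslope_expansion w f (w + h) 2; rewrite !psumS psum0 [w + h - w]addrAC subrr !add0r.
rewrite expr0 mulr1 expr1 [iter 0 _ _ _]/= [iter 1 _ _ _]/= dslope_eq => ->.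
set D := iter 2 _ _ _ in b *.
have -> : h^-1 * (f w + derive1 f w * h + h ^+ 2 * D - f w) - derive1 f w = h * D.
  by field.
by rewrite cmodM ler_wpM2l ?cmod_ge0.
Qed.

Lemma disc_disc w z r s : disc w r z -> disc z s `<=` disc w (r + s).
Proof. by rewrite /disc /= => zr x /= xs; have := cmodB_le x z w; lra. Qed.

(** The derivative is a uniform limit of difference quotients, which are analytic.
    The radius [r + r] leaves room to use discs of radius [r] around every point of
    the disc of radius [r]. *)
Lemma analytic_at_derive1 w r f : 0 < r ->
  (forall z, disc w (r + r) z -> analytic_at f z) -> analytic_at (derive1 f) w.
Proof.
move=> r0 fan; have rr : 0 <= r + r by lra.
have [M fM] := analytic_bounded rr fan.
(* any sequence of nonzero steps of modulus at most r tending to 0 would do *)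
pose h n : C := (r * 2^-1 ^+ n)%:C%C.
have p0 n : 0 < r * 2^-1 ^+ n by rewrite mulr_gt0// exprn_gt0// invr_gt0.
have ch n : cmod (h n) = r * 2^-1 ^+ n by rewrite cmod_real gtr0_norm.
have hr n : cmod (h n) <= r.
  by rewrite ch ger_pMr// exprn_ile1// ?invr_ge0// invf_le1// ler1n.
have h0 n : h n != 0 by rewrite -cmod_eq0 ch gt_eqF.
apply: (@unif_limit_analytic_at
  (fun n z => (h n)^-1 * (f (z + h n) - f z)) _ w r r0).
  move=> n z Dz; apply/analytic_atZ/analytic_atB; last first.
    by apply: fan; apply: disc_disc Dz z (disc_center z (ltW r0)).
  apply: analytic_at_shift; apply: fan; apply: disc_disc Dz _ _.
  by rewrite /disc /= addrAC subrr add0r.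
move=> e e0.
have := @geometric_small R (r * ((2 / r) ^+ 2 * M)) 2^-1 e.
rewrite invr_ge0 ler0n invf_lt1// ltr1n => /(_ isT e0).
apply: filterS => n small z Dz; apply: le_lt_trans small.
rewrite mulrAC -ch; apply: difference_quotient_bound => // x.
  by move=> /(disc_disc Dz); exact: fan.
by move=> /(disc_disc Dz); exact: fM.
Qed.

End CauchyEstimates.

(** * Equivalence with power series *)

Section PowerSeries.
Variable R : realType.
Local Notation C := (Cplx R).
Implicit Types (f g : C -> C) (w x y z : C) (rho B r M : R) (a : nat -> C).

Lemma eventually_bounded (u : nat -> R) (c : R) :
  (\forall n \near \oo, u n <= c) -> exists B : R, forall n, u n <= B.
Proof.
move=> [N _ uN]; exists (`|c| + \sum_(0 <= k < N) `|u k|) => n.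
have [Nn|nN] := leqP N n.
  apply: (le_trans (uN n Nn)); apply: (le_trans (ler_norm c)).
  by rewrite lerDl sumr_ge0.
apply: (le_trans (ler_norm (u n))).
rewrite big_mkord (bigD1 (Ordinal nN))//= addrCA lerDl addr_ge0// sumr_ge0//.
Qed.

(** With terms bounded by [B q^k / 2^k], the tail from [n] on is at most [B q^n]
    times a partial sum of [1 + 1/2 + 1/4 + ...], which is [2 - 2 / 2^j]. *)
Lemma psum_tail a z B q n j : 0 <= q <= 1 -> 0 <= B ->
  (forall k, cmod (a k * z ^+ k) <= B * q ^+ k * 2^-1 ^+ k) ->
  cmod (psum a z (n + j) - psum a z n) <= B * q ^+ n * (2 - 2 * 2^-1 ^+ j).
Proof.
move=> /andP[q0 q1] B0 aB; have Bq : 0 <= B * q ^+ n by rewrite mulr_ge0// exprn_ge0.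
elim: j => [|j IH]; first by rewrite addn0 subrr cmod0 expr0 mulr1 subrr mulr0.
rewrite addnS psumS addrAC; apply: (le_trans (cmodD _ _)).
have : cmod (a (n + j)%N * z ^+ (n + j)) <= B * q ^+ n * 2^-1 ^+ j.
  apply: (le_trans (aB _)); rewrite !exprD.
  have qj : q ^+ j <= 1 by rewrite exprn_ile1.
  have h2 : (2^-1 : R) ^+ n <= 1 by rewrite exprn_ile1// ?invr_ge0// invf_le1// ler1n.
  have p2 (i : nat) : (0 : R) <= 2^-1 ^+ i by rewrite exprn_ge0// invr_ge0.
  have qj0 : 0 <= q ^+ j by rewrite exprn_ge0.
  rewrite [B * (_ * _)]mulrA; apply: ler_pM; rewrite ?mulr_ge0 ?exprn_ge0 ?p2//.
    by rewrite ler_piMr.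
  by rewrite ler_piMl.
by move: IH; rewrite exprS; set x := B * _; set y := _ ^+ j; nra.
Qed.

(** At distance [r / 2] the terms of the convergent series tend to 0, hence are
    bounded; at distance less than [r / 4] they are dominated by a geometric
    progression of ratio 1/2. *)
Lemma series_taylor f w r a : 0 < r ->
  (forall z, cmod (z - w) < r -> series (fun k => a k * (z - w) ^+ k) @ \oo --> f z) ->
  analytic_at f w.
Proof.
move=> r0 fs; pose s := r / 2; have s0 : 0 < s by rewrite divr_gt0.
have sr : cmod (w + s%:C%C - w) < r.
  by rewrite addrAC subrr add0r cmod_real gtr0_norm// /s; lra.
have /cvg_series_cvg_0/cvg_cmodP/(_ 1 ltr01) : cvgn (series (fun k => a k * (w + s%:C%C - w) ^+ k)).
  by apply/cvg_ex; exists (f (w + s%:C%C)); exact: fs.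
rewrite addrAC subrr add0r => small.
have [B aB] : exists B, forall k, cmod (a k) * s ^+ k <= B.
  apply: (@eventually_bounded _ 1); apply: filterS small => k /ltW.
  by rewrite subr0 cmodM cmodX cmod_real gtr0_norm.
have B0 : 0 <= B by apply: le_trans (aB 0%N); rewrite expr0 mulr1 cmod_ge0.
have p0 : 0 < s / 2 by rewrite divr_gt0.
exists (s / 2), (2 * B), a; split => // n z zs.
set q := cmod z / (s / 2).
have q01 : 0 <= q <= 1.
  by rewrite /q divr_ge0 ?cmod_ge0 ?(ltW p0)//= ler_pdivrMr// mul1r (ltW zs).
have aq k : cmod (a k * z ^+ k) <= B * q ^+ k * 2^-1 ^+ k.
  rewrite cmodM cmodX -mulrA -exprMn.
  have -> : q * 2^-1 = cmod z / s by rewrite /q; field; rewrite gt_eqF.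
  rewrite expr_div_n mulrA mulrAC ler_wpM2r ?exprn_ge0 ?cmod_ge0//.
  by rewrite ler_pdivlMr ?exprn_gt0.
have zr : cmod (w + z - w) < r by rewrite addrAC subrr add0r /s in zs *; lra.
have /cvg_cmodP cz := fs _ zr.
apply/ler_addgt0Pr => e e0.
have [N _ /(_ (n + N)%N (leq_addl _ _))/=] := cz e e0.
rewrite /series /= [w + z - w]addrAC subrr add0r -/(psum a z (n + N)) => fN.
have := cmodB_le (f (w + z)) (psum a z (n + N)) (psum a z n).
have := psum_tail n N q01 B0 aq; rewrite (cmodBC (f (w + z)) (psum a z (n + N))).
have Bq : 0 <= B * q ^+ n by rewrite mulr_ge0// exprn_ge0//; case/andP: q01.
have h : 0 <= 2^-1 ^+ N :> R by rewrite exprn_ge0// invr_ge0.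
by have := mulr_ge0 Bq h; rewrite -[2 * B * _]mulrA; lra.
Qed.

Lemma taylor_series f w rho B a z : 0 < rho -> taylor f w rho B a ->
  cmod (z - w) < rho -> series (fun k => a k * (z - w) ^+ k) @ \oo --> f z.
Proof.
move=> r0 T zr; apply/cvg_cmodP => e e0.
have q01 : 0 <= cmod (z - w) / rho < 1.
  by rewrite divr_ge0 ?cmod_ge0 ?ltW//= ltr_pdivrMr// mul1r.
apply: filterS (geometric_small B q01 e0) => n; apply: le_lt_trans.
by have := T n _ zr; rewrite [w + _]addrC subrK cmodBC.
Qed.

Lemma ball_cmod w (r : R) z : ball w (r%:C%C : C) z <-> cmod (z - w) < r.
Proof. by rewrite -ball_normE /= distrC norm_cmod ltcR. Qed.

Lemma complex_gt0 (r : C) : 0 < r -> exists2 s : R, 0 < s & r = s%:C%C.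
Proof.
case: r => x y; rewrite ltcE /= => /andP[/eqP -> x0]; by exists x.
Qed.

(** The link with the definition by power series; openness allows the disc of
    convergence to be shrunk into [U]. *)
Lemma analyticP (U : set C) f : open U ->
  analytic U f <-> forall z, U z -> analytic_at f z.
Proof.
move=> oU; split => [fan z Uz|fan z Uz].
  have [r [a [/complex_gt0[s s0 ->] _ fs]]] := fan z Uz.
  by apply: (series_taylor s0) => x /ball_cmod; exact: fs.
have [rho [B [a [r0 T]]]] := fan z Uz.
have /nbhs_cmodP[e e0 eU] := oU z Uz.
exists (Num.min e rho)%:C%C, a; split.
- by rewrite ltcR lt_min e0.
- by move=> x /ball_cmod; rewrite lt_min => /andP[/eU].
- by move=> x /ball_cmod; rewrite lt_min => /andP[_]; exact: taylor_series T.
Qed.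

End PowerSeries.

(** * Locally uniform convergence of all derivatives *)

Section Convergence.
Variable R : realType.
Local Notation C := (Cplx R).
Implicit Types (f g : C -> C) (w x y z : C) (rho B r M : R) (a : nat -> C).

Lemma entourage_cmodP (E : set (C * C)) :
  entourage E <-> exists2 e : R, 0 < e & forall x y, cmod (x - y) < e -> E (x, y).
Proof.
rewrite -entourage_ballE; split.
  move=> [_ /= /complex_gt0[s s0 ->] sE]; exists s => // x y xy.
  by apply: sE; rewrite /= ball_cmod cmodBC.
move=> [e e0 eE]; exists (e%:C%C : C); first by rewrite /= ltcR.
by move=> [x y] /= /ball_cmod; rewrite cmodBC; exact: eE.
Qed.

Lemma cvg_uniform_cmodP (A : set C) (F : nat -> C -> C) f :
  {uniform A, F @ \oo --> f} <-> forall e : R, 0 < e ->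
    \forall n \near \oo, forall z, A z -> cmod (F n z - f z) < e.
Proof.
split => [FA e e0|FA P /uniform_nbhs[E [/entourage_cmodP[e e0 eE] EP]]].
  apply: (FA [set h | forall z, A z -> cmod (h z - f z) < e]).
  apply/uniform_nbhs; exists [set xy : C * C | cmod (xy.2 - xy.1) < e]; split => //.
  by apply/entourage_cmodP; exists e => // x y /=; rewrite cmodBC.
apply: filterS (FA e e0) => n Fn; apply: EP => z Az; apply: eE.
by rewrite cmodBC; exact: Fn.
Qed.

(** Uniform convergence on a disc around each point: the form in which the
    Cauchy estimates apply, stable under derivation. *)
Definition cvg_locally (U : set C) (F : nat -> C -> C) f := forall z, U z ->
  exists2 d : R, 0 < d & forall e : R, 0 < e ->
    \forall n \near \oo, forall x, disc z d x -> cmod (F n x - f x) < e.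

(** Compactness in the near-covering form turns the local choice of discs into a
    single threshold for [n]. *)
Lemma cvg_locally_compactly (U : set C) (F : nat -> C -> C) f :
  cvg_locally U F f -> cvg_compactly U F f.
Proof.
move=> FU; apply/fam_cvgP => K [KU cK]; apply/cvg_uniform_cmodP => e e0.
apply: ((compact_near_coveringP K).1 cK nat \oo (fun n x => cmod (F n x - f x) < e)).
move=> z /KU/FU[d d0 /(_ e e0) Fd].
exists ([set x | cmod (x - z) < d], [set n | forall x, disc z d x -> cmod (F n x - f x) < e]).
  by split => //=; apply/nbhs_cmodP; exists d.
by move=> [x n] /= [/ltW xd]; exact.
Qed.

Lemma open_disc (U : set C) z : open U -> U z -> exists2 d : R, 0 < d & disc z d `<=` U.
Proof.
move=> oU Uz; have /nbhs_cmodP[e e0 eU] := oU z Uz.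
exists (e / 2); first by rewrite divr_gt0.
by move=> x xe; apply: eU; move: xe; rewrite /disc /=; lra.
Qed.

Lemma disc_le z r s : r <= s -> disc z r `<=` disc z s.
Proof. by move=> rs x; rewrite /disc /= => /le_trans; exact. Qed.

Lemma analytic_derive1 (U : set C) f : open U ->
  (forall z, U z -> analytic_at f z) -> forall z, U z -> analytic_at (derive1 f) z.
Proof.
move=> oU fan z /(open_disc oU)[d d0 dU].
apply: (@analytic_at_derive1 _ _ (d / 2)); first by rewrite divr_gt0.
by rewrite -splitr => x /dU; exact: fan.
Qed.

(** A bound on [f_n - f] over a disc of radius [d] bounds the derivative of the
    difference at every point of the concentric disc of radius [d / 2]. *)
Lemma weierstrass (U : set C) (F : nat -> C -> C) f : open U ->
  (forall n z, U z -> analytic_at (F n) z) -> cvg_locally U F f ->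
  (forall z, U z -> analytic_at f z) /\
  cvg_locally U (fun n => derive1 (F n)) (derive1 f).
Proof.
move=> oU Fan FU.
have disc_cvg z : U z -> exists d : R, [/\ 0 < d, disc z d `<=` U & forall e : R, 0 < e ->
    \forall n \near \oo, forall x, disc z d x -> cmod (F n x - f x) < e].
  move=> Uz; have [d d0 dU] := open_disc oU Uz; have [d' d'0 Fd'] := FU z Uz.
  exists (Num.min d d'); split => [||e e0]; first by rewrite lt_min d0.
    by apply: subset_trans dU; apply: disc_le; rewrite ge_min lexx.
  apply: filterS (Fd' e e0) => n h x xd; apply: h; apply: disc_le xd.
  by rewrite ge_min lexx orbT.
have fan z : U z -> analytic_at f z.
  move=> /disc_cvg[d [d0 dU Fd]]; apply: (unif_limit_analytic_at d0 _ Fd).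
  by move=> n x /dU; exact: Fan.
split => // z /disc_cvg[d [d0 dU Fd]].
have h0 : 0 < d / 2 by rewrite divr_gt0.
exists (d / 2) => // e e0.
have e'0 : 0 < e * d / 8 by rewrite divr_gt0// mulr_gt0.
apply: filterS (Fd _ e'0) => n Fn x xz.
have sub := @disc_disc R _ _ _ (d / 2) xz; rewrite -splitr in sub.
have Ux : U x by apply/dU/sub; apply: disc_center; exact: ltW.
rewrite -derive1B; [|exact: Fan|exact: fan].
apply: (@le_lt_trans _ _ (2 / (d / 2) * (e * d / 8))).
  apply: derive1_bound => // y /sub zy; last exact/ltW/Fn.
  by apply: analytic_atB; [apply: Fan|apply: fan]; exact: dU.
have -> : 2 / (d / 2) * (e * d / 8) = e / 2 by field; rewrite gt_eqF.
lra.
Qed.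

Lemma weierstrass_derive1n (U : set C) (F : nat -> C -> C) f k : open U ->
  (forall n z, U z -> analytic_at (F n) z) -> cvg_locally U F f ->
  cvg_locally U (fun n => derive1n k (F n)) (derive1n k f).
Proof.
move=> oU Fan FU.
suff [] : (forall n z, U z -> analytic_at (derive1n k (F n)) z) /\
  cvg_locally U (fun n => derive1n k (F n)) (derive1n k f) by [].
elim: k => [//|k [IHan IHcvg]]; split => [n|].
  by rewrite derive1nS; exact: analytic_derive1 (IHan n).
by have [_] := weierstrass oU IHan IHcvg.
Qed.

Lemma within_continuousB (A : set C) f g :
  {within A, continuous f} -> {within A, continuous g} ->
  {within A, continuous (fun z => f z - g z)}.
Proof.
move=> /subspace_continuousP cf /subspace_continuousP cg.
by apply/subspace_continuousP => z Az; apply: cvgB; [exact: cf|exact: cg].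
Qed.

Lemma uniform_limit_within_continuous (A : set C) (F : nat -> C -> C) f :
  (forall n, {within A, continuous (F n)}) ->
  (forall e : R, 0 < e -> \forall n \near \oo, forall z, A z -> cmod (F n z - f z) < e) ->
  {within A, continuous f}.
Proof.
move=> cF Ff; apply/within_continuousP => z Az e e0.
have e3 : 0 < e / 3 by rewrite divr_gt0.
have [N _ /(_ N (leqnn N)) FN] := Ff _ e3.
have := (within_continuousP A (F N)).1 (cF N) z Az _ e3.
apply: filterS => x /[swap] Ax /(_ Ax) FNx.
have := cmodB_le (f x) (F N x) (f z); have := cmodB_le (F N x) (F N z) (f z).
have := FN x Ax; have := FN z Az; rewrite (cmodBC (F N x) (f x)); lra.
Qed.

Lemma bounded_cmod (A : set C) : bounded_set A ->
  exists N : R, forall z, A z -> cmod z <= N.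
Proof.
move=> [M [Mreal /(_ (M + 1))]]; rewrite ltrDl ltr01 => /(_ isT) AM.
exists (complex.Re (M + 1)) => z /AM /=; rewrite norm_cmod.
by case: (M + 1) => x y; rewrite lecE => /andP[].
Qed.

End Convergence.

Theorem corollary11p5 (R : realType) (Omega : set (Cplx R))
    (f_ : nat -> Cplx R -> Cplx R) :
  open Omega -> connected Omega -> bounded_set Omega ->
  (forall n, (analytic Omega `&` continuous_closure Omega) (f_ n)) ->
  (exists g : Cplx R -> Cplx R, {uniform boundary Omega, f_ @ \oo --> g}) ->
  [/\ forall k : nat, exists g : Cplx R -> Cplx R,
        cvg_compactly Omega (fun n => derive1n k (f_ n)) g,
      exists f : Cplx R -> Cplx R,
        forall z, closure Omega z -> f_ n z @[n --> \oo] --> f z &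
      forall f : Cplx R -> Cplx R,
        (forall z, closure Omega z -> f_ n z @[n --> \oo] --> f z) ->
        (analytic Omega `&` continuous_closure Omega) f /\
        (forall k : nat,
           cvg_compactly Omega (fun n => derive1n k (f_ n)) (derive1n k f))].
Proof.
move=> oO _ /bounded_cmod[B OB] f_an [g /cvg_uniform_cmodP f_g].
have fan n z : Omega z -> analytic_at (f_ n) z.
  by have [/(analyticP _ oO) + _] := f_an n; exact.
have fc n : {within closure Omega, continuous (f_ n)} by have [] := f_an n.
have cauchy (e : R) : 0 < e -> exists N, forall n m, (N <= n)%N -> (N <= m)%N ->
    forall z, closure Omega z -> cmod (f_ n z - f_ m z) <= e.
  move=> e0; have [N _ fN] := f_g _ (divr_gt0 e0 (ltr0Sn _ 1)).
  exists N => n m Nn Nm; apply: (maximum_principle oO OB).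
  - by move=> z Oz; apply: analytic_atB; exact: fan.
  - exact: within_continuousB.
  move=> z cOz nOz; have bz : boundary Omega z by split => // /interior_subset.
  have := cmodB_le (f_ n z) (g z) (f_ m z); have := fN n Nn z bz.
  by have := fN m Nm z bz; rewrite (cmodBC (g z)); lra.
have limf : exists f : Cplx R -> Cplx R,
    forall z, closure Omega z -> f_ n z @[n --> \oo] --> f z.
  suff /choice[f fP] : forall z, exists l : Cplx R,
      closure Omega z -> f_ n z @[n --> \oo] --> l by exists f.
  move=> z.
  have [cOz|nOz] := pselect (closure Omega z); last first.
    by exists 0 => /nOz.
  have [|l fl] := @cplx_complete R (fun n => f_ n z); last first.
    by exists l => _; exact: fl.
  move=> e e0; have [N fN] := cauchy _ (divr_gt0 e0 (ltr0Sn _ 1)).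
  by exists N => n m Nn Nm; apply: (le_lt_trans (fN n m Nn Nm z cOz)); lra.
have main (f : Cplx R -> Cplx R) :
    (forall z, closure Omega z -> f_ n z @[n --> \oo] --> f z) ->
    (analytic Omega `&` continuous_closure Omega) f /\
    (forall k : nat, cvg_compactly Omega (fun n => derive1n k (f_ n)) (derive1n k f)).
  move=> f_f.
  have unif (e : R) : 0 < e -> \forall n \near \oo, forall z, closure Omega z ->
      cmod (f_ n z - f z) < e.
    move=> e0; have [N fN] := cauchy _ (divr_gt0 e0 (ltr0Sn _ 1)).
    exists N => // n Nn z cOz; apply: (@le_lt_trans _ _ (e / 2)); last by lra.
    apply: (@cmod_lim_le _ (fun m => f_ n z - f_ m z)).
      by exists N => // m Nm; exact: fN.
    by apply: cvgB; [exact: cvg_cst|exact: f_f].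
  have loc : cvg_locally Omega f_ f.
    move=> z /(open_disc oO)[d d0 dO]; exists d => // e /unif.
    by apply: filterS => n h x /dO Ox; apply: h; exact: subset_closure.
  split; last by move=> k; apply: cvg_locally_compactly; exact: weierstrass_derive1n.
  split; first by apply/(analyticP _ oO); case: (weierstrass oO fan loc).
  exact: uniform_limit_within_continuous unif.
split => // k; have [f /main[_ fk]] := limf.
by exists (derive1n k f).
Qed.
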